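(* Let $\xi,\eta\in\mathsf{H}_U$ be non-zero vectors with $\langle\xi,\eta\rangle_U=0$, and let $\{T_k\}_{k\geq1}$ be a uniformly bounded sequence of bounded operators on $\mathcal{F}_q(\mathsf{H}_U)$. Then the sequences \begin{enumerate} \item $\frac1n\sum_{k=1}^n(1-q)^k\|\xi\|_U^{-k}\|\eta\|_U^{-k}\,c(\xi)^kc(\eta)^kT_k$, \item $\frac1n\sum_{k=1}^n(1-q)^k\|\xi\|_U^{-k}\|\eta\|_U^{-k}\,r(\xi)^kr(\eta)^kT_k$ \end{enumerate} converge to $0$ in operator norm as $n\to\infty$.
   Context: Let $q\in(-1,1)$, let $\mathsf{H}_{\mathbb{R}}$ be a real separable Hilbert space with $\dim\mathsf{H}_{\mathbb{R}}\geq2$, and let $\{U_t\}_{t\in\mathbb{R}}$ be a strongly continuous one-parameter group of orthogonal transformations on $\mathsf{H}_{\mathbb{R}}$. Inner products are linear in the second variable. Let $\mathsf{H}_{\mathbb{C}}=\mathsf{H}_{\mathbb{R}}+i\mathsf{H}_{\mathbb{R}}$ be the complexification, extend $\{U_t\}$ linearly to a unitary group on it, and let $A$ be the positive, self-adjoint, non-singular operator with $U_t=A^{it}$. Let $\mathsf{H}_U$ be the completion of $\mathsf{H}_{\mathbb{C}}$ for $\langle\xi,\zeta\rangle_U=\langle2(1+A^{-1})^{-1}\xi,\zeta\rangle_{\mathsf{H}_{\mathbb{C}}}$, with norm $\|\cdot\|_U$. The $q$-Fock space is $\mathcal{F}_q(\mathsf{H}_U)=\mathbb{C}\Omega\oplus\bigoplus_{n\geq1}\mathsf{H}_U^{\otimes_q^n}$,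 where $\Omega$ is a unit vector and $\mathsf{H}_U^{\otimes_q^n}$ is the completion of the $n$-fold algebraic tensor product of $\mathsf{H}_U$ for $\langle\xi_1\otimes\cdots\otimes\xi_n,\zeta_1\otimes\cdots\otimes\zeta_n\rangle_q=\sum_{\pi\in S_n}q^{|\pi|}\prod_{i=1}^n\langle\xi_i,\zeta_{\pi(i)}\rangle_U$, with $|\pi|$ the number of inversions of $\pi$. For $\xi\in\mathsf{H}_U$, the left and right $q$-creation operators $c(\xi)$, $r(\xi)$ are the bounded operators on $\mathcal{F}_q(\mathsf{H}_U)$ with $c(\xi)\Omega=r(\xi)\Omega=\xi$, $c(\xi)(\xi_1\otimes\cdots\otimes\xi_n)=\xi\otimes\xi_1\otimes\cdots\otimes\xi_n$ and $r(\xi)(\xi_1\otimes\cdots\otimes\xi_n)=\xi_1\otimes\cdots\otimes\xi_n\otimes\xi$. *)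

(* Defs.v *)
From HB Require Import structures.
From mathcomp Require Import all_boot all_order all_fingroup all_algebra.
From mathcomp Require Import sesquilinear.
From mathcomp Require Import all_classical all_reals all_analysis.
From mathcomp Require Import complex.

Set Implicit Arguments.
Unset Strict Implicit.
Unset Printing Implicit Defensive.

Import Order.TTheory GRing.Theory Num.Theory.
Import numFieldNormedType.Exports.

Local Open Scope classical_set_scope.
Local Open Scope ring_scope.
Local Open Scope complex_scope.

(* [theta] is the identity for real spaces and the conjugation for complex
   ones.  Over [R[i]] the norm is [R[i]]-valued, with real values. *)
HB.mixin Record isHilbert (K : numFieldType) (theta : K -> K) (V : Type)
    of CompleteNormedModule K V := {
  dotform : {dot V for theta};
  dotform_norm : forall x : V, dotform x x = `|x| ^+ 2
}.

#[short(type="hilbertType")]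
HB.structure Definition Hilbert (K : numFieldType) (theta : K -> K) :=
  {V of isHilbert K theta V & CompleteNormedModule K V}.

Notation realHilbertType R := (@hilbertType R idfun).
Notation complexHilbertType R := (@hilbertType R[i] (@conjc R)).

(* Linear in the second argument, whereas [{dot _ for _}] is linear in the
   first one. *)
Definition inner (K : numFieldType) (theta : K -> K)
    (V : hilbertType theta) (x y : V) : K :=
  @dotform K theta V y x.

Definition separable (T : topologicalType) :=
  exists2 D : set T, countable D & dense D.

Definition dim_ge2 (K : numFieldType) (V : lmodType K) :=
  exists x y : V, forall a b : K, a *: x + b *: y = 0 -> a = 0 /\ b = 0.

(* Each [U t] is onto, being inverse to [U (- t)]. *)
Definition orthogonal_group (R : realType) (H : realHilbertType R)
    (U : R -> {linear H -> H}) : Prop :=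
  [/\ forall x, U 0 x = x,
      forall s t x, U (s + t) x = U s (U t x),
      forall t x y, inner (U t x) (U t y) = inner x y
    & forall x, continuous (fun t : R => U t x)].

(* [HC], with the embedding [j], is the Hilbert space [HR + i HR]. *)
Definition complexification (R : realType) (HR : realHilbertType R)
    (HC : complexHilbertType R) (j : HR -> HC) : Prop :=
  [/\ forall (a : R) x y, j (a *: x + y) = a%:C *: j x + j y,
      forall x y, inner (j x) (j y) = (inner x y)%:C
    & forall z, exists x y, z = j x + 'i%C *: j y].

(* Unbounded operators are represented by their graphs, so that an equality of
   operators includes the equality of their domains. *)
Section UnboundedOperators.
Variables (R : realType) (H : complexHilbertType R).
Implicit Types G : set (H * H).

Definition op_dom G : set H := [set x | exists y, G (x, y)].

Definition op_inv G : set (H * H) := [set p | G (p.2, p.1)].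

Definition op_one_plus G : set (H * H) :=
  [set p | exists2 y, G (p.1, y) & p.2 = p.1 + y].

Definition op_adjoint G : set (H * H) :=
  [set p | forall u v, G (u, v) -> inner p.1 v = inner p.2 u].

Definition self_adjoint G := dense (op_dom G) /\ op_adjoint G = G.

Definition positive_op G := forall x y, G (x, y) -> 0 <= inner x y.

Definition nonsingular_op G := forall x, G (x, 0) -> x = 0.

(* A projection-valued measure [E] on the Borel sets of the line; [mu x] is
   its scalar measure <x, E(.)x>. *)
Definition spectral_measure (E : set R -> {linear H -> H})
    (mu : H -> {measure set (measurableTypeR R) -> \bar R}) : Prop :=
  [/\ forall x, E setT x = x,
      forall (B : set (measurableTypeR R)) x y, measurable B ->
        inner (E B x) y = inner x (E B y),
      forall (B C : set (measurableTypeR R)) x, measurable B -> measurable C ->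
        E (B `&` C) x = E B (E C x)
    & forall (B : set (measurableTypeR R)) x, measurable B ->
        mu x B = (complex.Re (inner x (E B x)))%:E].

(* [G] is the integral of l and [U t] that of l^(it) against a spectral measure
   carried by the positive half-line.  Both are given by their diagonal
   coefficients <x, . x>, which determine them by polarization, and
   l^(it) = cos (t ln l) + i sin (t ln l). *)
Definition imaginary_powers G (U : R -> {linear H -> H}) : Prop :=
  exists (E : set R -> {linear H -> H})
         (mu : H -> {measure set (measurableTypeR R) -> \bar R}),
  [/\ spectral_measure E mu,
      forall x, E `]0, +oo[%classic x = x,
      forall x, op_dom G x <-> (\int[mu x]_l ((l ^+ 2)%:E) < +oo)%E,
      forall x y, G (x, y) -> inner x y = (\int[mu x]_l l)%:C
    & forall t x, inner x (U t x) =
        (\int[mu x]_(l in `]0, +oo[%classic) cos (t * ln l)) +i*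
        (\int[mu x]_(l in `]0, +oo[%classic) sin (t * ln l))].

End UnboundedOperators.

(* [HU] is the completion of [HC] for <x, y>_U = <2 (1 + A^-1)^-1 x, y>. *)
Definition deformed_completion (R : realType) (HC : complexHilbertType R)
    (A : set (HC * HC)) (HU : complexHilbertType R)
    (iota : {linear HC -> HU}) : Prop :=
  (forall x, exists2 z, op_inv (op_one_plus (op_inv A)) (x, z) &
     forall y, inner (iota x) (iota y) = inner (2 *: z) y) /\
  dense (range iota).

Definition inversions (n : nat) (s : 'S_n) : nat :=
  #|[pred p : 'I_n * 'I_n | (p.1 < p.2)%N && (s p.2 < s p.1)%N]|.

(* The q-inner product of the elementary tensors on [s] and [t]; tensors of
   different degrees are orthogonal. *)
Definition q_form (R : realType) (q : R) (H : complexHilbertType R)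
    (s t : seq H) : R[i] :=
  if size s == size t then
    \sum_(p : 'S_(size s))
      q%:C ^+ inversions p * \prod_(i < size s) inner s`_i t`_(p i)
  else 0.

(* [F] is the q-Fock space over [H]: the completion of the tensor algebra of
   [H] for the q-inner product.  [tens [:: x_1; ...; x_n]] is the elementary
   tensor of x_1, ..., x_n, and [tens [::]] is the vacuum vector. *)
Definition q_fock (R : realType) (q : R) (H F : complexHilbertType R)
    (tens : seq H -> F) : Prop :=
  [/\ forall (s t : seq H) (a : R[i]) (x y : H),
        tens (s ++ (a *: x + y) :: t) =
        a *: tens (s ++ x :: t) + tens (s ++ y :: t),
      forall s t, inner (tens s) (tens t) = q_form q s t
    & dense [set v | exists m (a : 'I_m -> R[i]) (s : 'I_m -> seq H),
               v = \sum_(k < m) a k *: tens (s k)]].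

Section BoundedOperators.
Variables (R : realType) (F : complexHilbertType R).

Definition bounded_op (S : {linear F -> F}) :=
  exists M : R, forall x, `|S x| <= M%:C * `|x|.

(* Extended-real-valued, so that it is meaningful without a prior bound. *)
Definition opnorm (S : F -> F) : \bar R :=
  ereal_sup [set (complex.Re `|S x|)%:E | x in [set x | `|x| <= 1]].

Definition left_creation (H : complexHilbertType R) (tens : seq H -> F)
    (c : H -> {linear F -> F}) : Prop :=
  forall x, bounded_op (c x) /\ forall s, c x (tens s) = tens (x :: s).

Definition right_creation (H : complexHilbertType R) (tens : seq H -> F)
    (r : H -> {linear F -> F}) : Prop :=
  forall x, bounded_op (r x) /\ forall s, r x (tens s) = tens (rcons s x).

(* The averages (1/n) sum_(k = 1)^n (1-q)^k |x|^-k |y|^-k a(x)^k a(y)^k T_k. *)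
Definition creation_average (q : R) (H : complexHilbertType R)
    (a : H -> {linear F -> F}) (x y : H) (T : nat -> {linear F -> F})
    (n : nat) (v : F) : F :=
  n%:R^-1 *: \sum_(1 <= k < n.+1)
    ((1 - q)%:C ^+ k * `|x| ^- k * `|y| ^- k) *:
      iter k (a x) (iter k (a y) (T k v)).

End BoundedOperators.

(* Main.v *)
(* Normalise to a = sqrt(1 - q) |xi|^-1 c(xi) and b = sqrt(1 - q) |eta|^-1 c(eta),
   so that the averaged terms are a^k b^k T_k.  The q-commutation relations read
   a'a = (1 - q) + q aa', the same for b, and a'b = q ba' because xi and eta are
   orthogonal.  With D = 1 - aa' one has a'a = 1 - qD and Da = q aD, whence
     <a^k x, a^k y> = <x, (1 - qD) ... (1 - q^k D) y>;
   these products are bounded uniformly in k, and so are the powers of a and b.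
   For j < k, moving a^(k - j) through D and then its adjoint through b^j bounds
   <a^j b^j x, a^k b^k y> by a constant times |q|^(j (k - j)) <= |q|^j.  The terms
   are thus almost orthogonal, the squared norm of their sum up to n is O(n), and
   the averages are O(n^(-1/2)).  The statement for r is the one for c with the
   elementary tensors read backwards. *)
Require Import Defs.
From HB Require Import structures.
From mathcomp Require Import all_boot all_order all_fingroup all_algebra.
From mathcomp Require Import sesquilinear.
From mathcomp Require Import all_classical all_reals all_analysis.
From mathcomp Require Import complex.
From mathcomp Require Import ring lra zify.

Set Implicit Arguments.
Unset Strict Implicit.
Unset Printing Implicit Defensive.

Import Order.TTheory GRing.Theory Num.Theory.
Import numFieldNormedType.Exports.

Local Open Scope classical_set_scope.
Local Open Scope ring_scope.
Local Open Scope complex_scope.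

Lemma inversions_sum n (s : 'S_n) :
  inversions s = (\sum_(i < n) \sum_(j < n) ((i < j) && (s j < s i)))%N.
Proof.
rewrite /inversions -sum1_card pair_big /= big_mkcond /=.
by apply: eq_bigr => -[i j] _ /=; rewrite inE /=; case: (_ && _).
Qed.

Lemma inversions_lift n (i : 'I_n.+1) (s : 'S_n) :
  inversions (lift_perm ord0 i s) = (i + inversions s)%N.
Proof.
rewrite !inversions_sum big_ord_recl big_ord_recl /= add0n; congr (_ + _)%N.
  under eq_bigr do rewrite lift_perm_id lift_perm_lift /=.
  rewrite (reindex_inj (@perm_inj _ s^-1)) /=.
  under eq_bigr do rewrite permKV.
  have -> : (\sum_(j < n) (lift i j < i) = \sum_(j < n | (j < i)%N) 1)%N.
    rewrite [RHS]big_mkcond; apply: eq_bigr => j _ /=.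
    by rewrite /bump leqNgt; case: (ltnP j i) => /= h; lia.
  by rewrite -(big_ord_widen n (fun=> 1%N)) ?sum1_card ?card_ord // -ltnS.
apply: eq_bigr => j _; rewrite big_ord_recl /= add0n.
apply: eq_bigr => k _; rewrite !lift_perm_lift /= ltnS.
by congr (_ && _ : nat); rewrite /bump; do 2 case: leqP => ?; lia.
Qed.

Lemma big_perm_cons (V : nmodType) n (f : 'S_n.+1 -> V) :
  \sum_(s : 'S_n.+1) f s = \sum_(i < n.+1) \sum_(s : 'S_n) f (lift_perm ord0 i s).
Proof.
rewrite pair_big /= (reindex (fun p : 'I_n.+1 * 'S_n => lift_perm ord0 p.1 p.2)) //=.
pose g (s : {perm 'I_n.+1}) (k : 'I_n) := odflt k (unlift (s ord0) (s (lift ord0 k))).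
have gK (s : {perm 'I_n.+1}) (k : 'I_n) : lift (s ord0) (g s k) = s (lift ord0 k).
  rewrite /g; have := neq_lift ord0 k.
  by rewrite -(inj_eq (@perm_inj _ s)) => /unlift_some[] ? ? ->.
have g_inj s : injective (g s).
  move=> j k ejk; apply: (@lift_inj _ ord0); apply: (@perm_inj _ s).
  by rewrite -!gK ejk.
exists (fun s : {perm 'I_n.+1} => (s ord0, perm (g_inj s))) => [[i s] _ | s _] /=.
  rewrite lift_perm_id; congr pair; apply/permP => k.
  by rewrite permE /g lift_perm_lift lift_perm_id liftK.
apply/permP => k; case: (unliftP ord0 k) => [k'|] ->; rewrite ?lift_perm_id //.
by rewrite lift_perm_lift permE gK.
Qed.

Definition delete_nth (T : Type) i (t : seq T) := take i t ++ drop i.+1 t.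

Lemma size_delete_nth (T : Type) i (t : seq T) :
  (i < size t)%N -> size (delete_nth i t) = (size t).-1.
Proof. by move=> h; rewrite size_cat size_take h size_drop; lia. Qed.

Lemma nth_delete_nth (T : Type) (x : T) i t j : (i < size t)%N ->
  nth x (delete_nth i t) j = nth x t (bump i j).
Proof.
move=> h; rewrite nth_cat size_take h /bump; case: ltnP => hj.
  by rewrite nth_take // add0n.
by rewrite nth_drop; congr nth; lia.
Qed.

Section QForm.
Variables (R : realType) (q : R) (H : complexHilbertType R).
Implicit Types s t : seq H.

Lemma q_form_cons x s t :
  q_form q (x :: s) t =
  \sum_(i < size t) q%:C ^+ i * inner x t`_i * q_form q s (delete_nth i t).
Proof.
rewrite /q_form /=; case: eqP => [ht|hst]; last first.
  rewrite big1 // => i _; rewrite size_delete_nth //.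
  case: eqP => [hs|]; last by rewrite mulr0.
  by case: hst; rewrite hs prednK // (leq_trans _ (ltn_ord i)).
rewrite big_perm_cons -ht; apply: eq_bigr => i _.
have hi : (i < size t)%N by rewrite -ht.
rewrite size_delete_nth // -ht eqxx mulr_sumr; apply: eq_bigr => p _.
rewrite inversions_lift exprD big_ord_recl lift_perm_id /=.
rewrite mulrACA; congr (_ * _ * (_ * _)); apply: eq_bigr => k _.
by rewrite lift_perm_lift nth_delete_nth.
Qed.

Lemma q_form_rev s t : q_form q (rev s) (rev t) = q_form q s t.
Proof.
rewrite /q_form !size_rev; case: eqP => [hst|//].
have rinj : injective (@rev_ord (size s)) by exact: rev_ord_inj.
pose rho := perm rinj; have rhoK : (rho * rho = 1)%g.
  by apply/permP => i; rewrite permM !permE rev_ordK.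
pose cj (p : 'S_(size s)) := (rho * p * rho)%g.
have cjK : involutive cj.
  by move=> p; rewrite /cj !mulgA rhoK mul1g -mulgA rhoK mulg1.
have cjE p i : cj p i = rev_ord (p (rev_ord i)).
  by rewrite /cj !permM !permE.
rewrite (reindex_inj (inv_inj cjK)) /=; apply: eq_bigr => p _.
congr (_ ^+ _ * _).
  rewrite !inversions_sum [RHS]exchange_big /=.
  rewrite (reindex_inj rev_ord_inj) /=; apply: eq_bigr => i _.
  rewrite (reindex_inj rev_ord_inj) /=; apply: eq_bigr => k _.
  rewrite !cjE !rev_ordK /=; congr (_ && _ : nat).
    by have := ltn_ord i; have := ltn_ord k; lia.
  by have := ltn_ord (p i); have := ltn_ord (p k); lia.
rewrite (reindex_inj rev_ord_inj) /=; apply: eq_bigr => i _.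
rewrite cjE rev_ordK /= !nth_rev -?hst //;
  last by rewrite ltn_subrL /=; case: (size s) (p i) => [[]|].
  by congr inner; congr nth; [have := ltn_ord i|have := ltn_ord (p i)]; lia.
by have := ltn_ord i; lia.
Qed.

End QForm.

Section RealInnerProduct.
Variables (R : realType) (H : complexHilbertType R).
Implicit Types (x y z : H) (a : R[i]) (r : R).

Lemma innerDr x y z : inner x (y + z) = inner x y + inner x z.
Proof. exact: linearDl. Qed.

Lemma innerZr a x y : inner x (a *: y) = a * inner x y.
Proof. exact: linearZl_LR. Qed.

Lemma inner0r x : inner x 0 = 0.
Proof. exact: linear0l. Qed.

Lemma inner_sumr (I : Type) (s : seq I) (P : pred I) (f : I -> H) x :
  inner x (\sum_(i <- s | P i) f i) = \sum_(i <- s | P i) inner x (f i).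
Proof. exact: (big_morph _ (innerDr x) (inner0r x)). Qed.

Lemma innerC x y : inner x y = conjc (inner y x).
Proof.
by rewrite /inner (@hermitian_subproof _ _ false _ dotform y x) expr0 mul1r.
Qed.

Lemma innerZl a x y : inner (a *: x) y = conjc a * inner x y.
Proof. by rewrite (innerC (a *: x)) innerZr rmorphM /= -innerC. Qed.

Definition rdot x y : R := complex.Re (inner x y).
Definition nrm x : R := complex.Re `|x|.

Lemma nrmE x : `|x| = (nrm x)%:C.
Proof. by rewrite RRe_real // ger0_real. Qed.

Lemma nrm_le x y r : (`|x| <= r%:C * `|y|) = (nrm x <= r * nrm y).
Proof. by rewrite !nrmE -rmorphM lecR. Qed.

Lemma nrm_ge0 x : 0 <= nrm x.
Proof. by rewrite -lecR -nrmE normr_ge0. Qed.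

Lemma nrm_eq0 x : (nrm x == 0) = (x == 0).
Proof. by rewrite -(normr_eq0 x) nrmE (inj_eq (@complexI R) _ 0). Qed.

Lemma nrmZ a x : nrm (a *: x) = complex.Re `|a| * nrm x.
Proof.
by apply: complexI; rewrite -nrmE normrZ rmorphM /= -nrmE.
Qed.

Lemma nrmZr r x : nrm (r%:C *: x) = `|r| * nrm x.
Proof. by rewrite nrmZ normc_def /= expr0n addr0 sqrtr_sqr. Qed.

Lemma nrmD x y : nrm (x + y) <= nrm x + nrm y.
Proof. by rewrite -lecR rmorphD /= -!nrmE ler_normD. Qed.

Lemma nrmN x : nrm (- x) = nrm x.
Proof. by rewrite /nrm normrN. Qed.

Lemma nrmB x y : nrm (x - y) <= nrm x + nrm y.
Proof. by rewrite -(nrmN y) nrmD. Qed.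

Lemma rdotC x y : rdot x y = rdot y x.
Proof. by rewrite /rdot innerC; case: (inner y x). Qed.

Lemma rdotDr x y z : rdot x (y + z) = rdot x y + rdot x z.
Proof. by rewrite /rdot innerDr; case: (inner x y) (inner x z) => ? ? []. Qed.

Lemma rdotDl x y z : rdot (y + z) x = rdot y x + rdot z x.
Proof. by rewrite rdotC rdotDr !(rdotC x). Qed.

Lemma rdotZr r x y : rdot x (r%:C *: y) = r * rdot x y.
Proof. by rewrite /rdot innerZr; case: (inner x y) => ? ? /=; rewrite mul0r subr0. Qed.

Lemma rdotZl r x y : rdot (r%:C *: x) y = r * rdot x y.
Proof. by rewrite rdotC rdotZr rdotC. Qed.

Lemma rdot_conj a x y : rdot x (a *: y) = rdot (conjc a *: x) y.
Proof. by rewrite /rdot innerZr innerZl conjcK. Qed.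

Lemma rdot0r x : rdot x 0 = 0.
Proof. by rewrite /rdot inner0r. Qed.

Lemma rdotNr x y : rdot x (- y) = - rdot x y.
Proof. by apply/eqP; rewrite -addr_eq0 -rdotDr addNr rdot0r. Qed.

Lemma rdotBr x y z : rdot x (y - z) = rdot x y - rdot x z.
Proof. by rewrite rdotDr rdotNr. Qed.

Lemma rdotBl x y z : rdot (y - z) x = rdot y x - rdot z x.
Proof. by rewrite rdotC rdotBr !(rdotC x). Qed.

Lemma rdot_suml (I : Type) (s : seq I) (P : pred I) (f : I -> H) x :
  rdot (\sum_(i <- s | P i) f i) x = \sum_(i <- s | P i) rdot (f i) x.
Proof.
apply: (big_morph (fun y => rdot y x)) => [y z|]; first exact: rdotDl.
by rewrite rdotC rdot0r.
Qed.

Lemma rdotxx x : rdot x x = nrm x ^+ 2.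
Proof. by rewrite /rdot /inner dotform_norm nrmE -rmorphXn. Qed.

Lemma nrmD_sqr x y : nrm (x + y) ^+ 2 = nrm x ^+ 2 + 2 * rdot x y + nrm y ^+ 2.
Proof. by rewrite -!rdotxx rdotDl !rdotDr (rdotC y x); ring. Qed.

Lemma rdot_le x y : rdot x y <= nrm x * nrm y.
Proof.
have [/eqP|xy] := eqVneq (nrm x * nrm y) 0.
  rewrite mulf_eq0 !nrm_eq0 => /orP[]/eqP ->; last by rewrite rdot0r mulr_ge0 ?nrm_ge0.
  by rewrite rdotC rdot0r mulr_ge0 ?nrm_ge0.
have {}xy : 0 < nrm x * nrm y by rewrite lt_neqAle eq_sym xy mulr_ge0 ?nrm_ge0.
have : 0 <= nrm ((nrm y)%:C *: x + (- nrm x)%:C *: y) ^+ 2 by rewrite sqr_ge0.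
rewrite nrmD_sqr !nrmZr rdotZl rdotZr normrN !ger0_norm ?nrm_ge0 //.
nra.
Qed.

Lemma normr_rdot_le x y : `|rdot x y| <= nrm x * nrm y.
Proof.
by rewrite ler_norml rdot_le andbT lerNl -rdotNr (le_trans (rdot_le _ _)) ?nrmN.
Qed.

Lemma rdot_inj x y : (forall z, rdot z x = rdot z y) -> x = y.
Proof.
move=> e; apply/eqP; rewrite -subr_eq0 -nrm_eq0 -sqrf_eq0 -rdotxx rdotBr.
by rewrite e subrr.
Qed.

Lemma nrm_le_dual x r : 0 <= r -> (forall y, rdot y x <= r * nrm y) -> nrm x <= r.
Proof.
move=> r0 h; have := h x; rewrite rdotxx.
have [->//|x0] := eqVneq (nrm x) 0.
by rewrite expr2 ler_pM2r // lt_neqAle eq_sym x0 nrm_ge0.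
Qed.

End RealInnerProduct.

Section AbstractEstimate.
Variables (R : realType) (F : complexHilbertType R).
Implicit Types (u v w : F) (a b : {linear F -> F}).

Lemma linear_iter a k (r : R[i]) v : iter k a (r *: v) = r *: iter k a v.
Proof. by elim: k => //= k ->; rewrite linearZ. Qed.

Lemma almost_orthogonal_sum (x : nat -> F) (t C : R) (n : nat) :
  0 <= t < 1 -> 0 <= C ->
  (forall k, (0 < k)%N -> nrm (x k) ^+ 2 <= C) ->
  (forall j k, (0 < j < k)%N -> rdot (x j) (x k) <= C * t ^+ j) ->
  nrm (\sum_(1 <= k < n.+1) x k) ^+ 2 <= n%:R * (C + 2 * C / (1 - t)).
Proof.
move=> /andP[t0 t1] C0 hd ho; elim: n => [|n IH].
  by rewrite big_nil /nrm normr0 expr0n mul0r.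
rewrite big_nat_recr //= nrmD_sqr -natr1.
have hx := hd n.+1 isT.
suff : rdot (\sum_(1 <= k < n.+1) x k) (x n.+1) <= C / (1 - t).
  by move: IH hx; set S := rdot _ _; rewrite -[2 * C / _]mulrA; lra.
rewrite rdot_suml.
apply: (@le_trans _ _ (\sum_(1 <= k < n.+1) C * t ^+ k)).
  by rewrite !big_nat; apply: ler_sum => k hk; apply: ho; lia.
rewrite -mulr_sumr ler_wpM2l // -[leRHS]mul1r ler_pdivlMr ?subr_gt0 //.
have -> m : (\sum_(1 <= k < m.+1) t ^+ k) * (1 - t) = t - t ^+ m.+1.
  elim: m => [|m IHm]; first by rewrite big_nil mul0r expr1 subrr.
  by rewrite big_nat_recr //= mulrDl IHm [t ^+ m.+2]exprS; ring.
by have := exprn_ge0 n.+1 t0; lra.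
Qed.

Variable q : R.
Hypothesis hq : -1 < q < 1.

Let q_lt1 : `|q| < 1.
Proof. by rewrite ltr_norml. Qed.

Section Oscillator.
Variables a a' : {linear F -> F}.
Variable L : R.
Hypothesis L0 : 0 <= L.
Hypothesis adj : forall u v, rdot (a u) v = rdot u (a' v).
Hypothesis com : forall v, a' (a v) = (1 - q)%:C *: v + q%:C *: a (a' v).
Hypothesis bnd : forall v, nrm (a v) <= L * nrm v.

Lemma nrm_adjoint v : nrm (a' v) <= L * nrm v.
Proof.
apply: nrm_le_dual => [|u]; first by rewrite mulr_ge0 ?nrm_ge0.
by rewrite -adj (le_trans (rdot_le _ _)) // mulrAC ler_wpM2r ?nrm_ge0.
Qed.

Let D v := v - a (a' v).

Let adj_com v : a' (a v) = v - q%:C *: D v.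
Proof.
rewrite com /D rmorphB /= scalerBl scale1r scalerBr opprB -addrA.
by congr (_ + _); rewrite addrC.
Qed.

Let D_a v : D (a v) = q%:C *: a (D v).
Proof. by rewrite {1}/D adj_com linearB /= linearZ opprB addrC subrK. Qed.

Let D_bound v : nrm (D v) <= (1 + L ^+ 2) * nrm v.
Proof.
rewrite (le_trans (nrmB _ _)) // mulrDl mul1r lerD2l.
by rewrite (le_trans (bnd _)) // expr2 -mulrA ler_wpM2l // nrm_adjoint.
Qed.

(* [osc_poly c k] is the product of the operators 1 - c q^i D, 1 <= i <= k. *)
Fixpoint osc_poly (c : R) k v :=
  if k is k'.+1 then
    let w := osc_poly (c * q) k' v in w - (c * q)%:C *: (w - a (a' w))
  else v.

Lemma osc_poly_a c k v : osc_poly c k (a v) = a (osc_poly (c * q) k v).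
Proof.
elim: k c v => //= k IH c v; rewrite IH; set w := osc_poly _ _ _.
by rewrite -/(D (a w)) -/(D w) D_a scalerA -rmorphM [RHS]linearB [in RHS]linearZ.
Qed.

Lemma osc_poly_iter c k m v :
  osc_poly c k (iter m a v) = iter m a (osc_poly (c * q ^+ m) k v).
Proof.
elim: m c => [|m IH] c; first by rewrite mulr1.
by rewrite /= osc_poly_a IH exprS mulrA.
Qed.

Lemma rdot_iter k u v : rdot (iter k a u) (iter k a v) = rdot u (osc_poly 1 k v).
Proof.
elim: k u v => [//|k IH] u v.
by rewrite !iterSr IH osc_poly_a adj adj_com /= mul1r.
Qed.

Definition osc_bound := expR ((1 + L ^+ 2) / (1 - `|q|)).

Lemma osc_bound_ge1 : 1 <= osc_bound.
Proof.
by rewrite -[leLHS]expR0 ler_expR divr_ge0 ?subr_ge0 ?(ltW q_lt1) // addr_ge0 ?sqr_ge0.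
Qed.

Lemma osc_poly_bound c k v : `|c| <= 1 -> nrm (osc_poly c k v) <= osc_bound * nrm v.
Proof.
have p0 : 0 < 1 - `|q| by rewrite subr_gt0.
set d := 1 + L ^+ 2; have d0 : 0 <= d by rewrite addr_ge0 ?sqr_ge0.
suff h e : nrm (osc_poly e k v) <= expR (`|e| * (`|q| * d / (1 - `|q|))) * nrm v.
  move=> c1; apply: le_trans (h c) _; rewrite ler_wpM2r ?nrm_ge0 // ler_expR.
  rewrite !mulrA ler_wpM2r ?invr_ge0 ?(ltW p0) // -[leRHS]mul1r ler_wpM2r //.
  by rewrite mulr_ile1 // ltW.
elim: k e => [|k IH] e /=.
  rewrite -[leLHS]mul1r ler_wpM2r ?nrm_ge0 // -[leLHS]expR0 ler_expR.
  by rewrite mulr_ge0 // divr_ge0 ?(ltW p0) // mulr_ge0.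
set w := osc_poly _ _ _; apply: le_trans (nrmB _ _) _; rewrite nrmZr.
apply: (@le_trans _ _ ((1 + `|e * q| * d) * nrm w)).
  by rewrite mulrDl mul1r lerD2l -mulrA ler_wpM2l // D_bound.
have -> : `|e| * (`|q| * d / (1 - `|q|)) =
    `|e * q| * d + `|e * q| * (`|q| * d / (1 - `|q|)).
  by rewrite normrM; field; rewrite gt_eqF.
rewrite expRD -mulrA; apply: ler_pM => //; rewrite ?nrm_ge0 ?expR_ge1Dx //.
  by rewrite addr_ge0 // mulr_ge0.
exact: IH.
Qed.

Lemma iter_bound k v : nrm (iter k a v) <= osc_bound * nrm v.
Proof.
have K1 := osc_bound_ge1; have K0 : 0 <= osc_bound by apply: le_trans K1.
rewrite -(@ler_pXn2r _ 2%N) ?nnegrE ?mulr_ge0 ?nrm_ge0 //.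
rewrite -rdotxx rdot_iter (le_trans (rdot_le _ _)) //.
apply: (@le_trans _ _ (nrm v * (osc_bound * nrm v))).
  by rewrite ler_wpM2l ?nrm_ge0 // osc_poly_bound // normr1.
by have := nrm_ge0 v; move: K1; nra.
Qed.

Lemma iter_adj k u v : rdot (iter k a u) v = rdot u (iter k a' v).
Proof. by elim: k u v => [//|k IH] u v; rewrite iterSr IH adj. Qed.

Lemma iter_adjoint_bound k v : nrm (iter k a' v) <= osc_bound * nrm v.
Proof.
have K0 : 0 <= osc_bound by apply: le_trans osc_bound_ge1.
apply: nrm_le_dual => [|u]; first by rewrite mulr_ge0 ?nrm_ge0.
by rewrite -iter_adj (le_trans (rdot_le _ _)) // mulrAC ler_wpM2r ?nrm_ge0 ?iter_bound.
Qed.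

End Oscillator.

Section Pair.
Variables a a' b b' : {linear F -> F}.
Variable L : R.
Hypothesis L0 : 0 <= L.
Hypothesis adja : forall u v, rdot (a u) v = rdot u (a' v).
Hypothesis coma : forall v, a' (a v) = (1 - q)%:C *: v + q%:C *: a (a' v).
Hypothesis bnda : forall v, nrm (a v) <= L * nrm v.
Hypothesis adjb : forall u v, rdot (b u) v = rdot u (b' v).
Hypothesis comb : forall v, b' (b v) = (1 - q)%:C *: v + q%:C *: b (b' v).
Hypothesis bndb : forall v, nrm (b v) <= L * nrm v.
Hypothesis cross : forall v, a' (b v) = q%:C *: b (a' v).

Lemma iter_cross m j v :
  iter m a' (iter j b v) = ((q ^+ j) ^+ m)%:C *: iter j b (iter m a' v).
Proof.
have h k w : a' (iter k b w) = (q ^+ k)%:C *: iter k b (a' w).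
  elim: k => [|k IH] /=; first by rewrite expr0 scale1r.
  by rewrite cross IH linearZ /= scalerA -rmorphM exprS.
elim: m => [|m IH] /=; first by rewrite expr0 scale1r.
by rewrite IH linearZ /= h scalerA -rmorphM -exprSr.
Qed.

Let K := osc_bound L.

Let K0 : 0 <= K. Proof. by apply: le_trans (osc_bound_ge1 _). Qed.

Lemma pair_cross_bound j k u w : (0 < j < k)%N ->
  rdot (iter j a (iter j b u)) (iter k a (iter k b w)) <=
  K ^+ 4 * nrm u * nrm w * `|q| ^+ j.
Proof.
move=> /andP[j0 jk]; have [m km m0] : exists2 m, k = (j + m)%N & (0 < m)%N.
  by exists (k - j)%N; lia.
rewrite {1}km iterD (rdot_iter adja coma) (osc_poly_iter coma) mul1r.
rewrite rdotC (iter_adj adja) iter_cross rdotZr.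
apply: le_trans (ler_norm _) _; rewrite normrM mulrC.
have -> : K ^+ 4 * nrm u * nrm w * `|q| ^+ j =
   (K * (K * nrm w)) * (K * (K * nrm u)) * `|q| ^+ j by ring.
apply: ler_pM => //.
  apply: le_trans (normr_rdot_le _ _) _; apply: ler_pM; rewrite ?nrm_ge0 //.
    apply: le_trans (osc_poly_bound L0 adja bnda _ _ _) _.
      by rewrite normrX exprn_ile1 // ltW.
    by rewrite ler_wpM2l // (iter_bound L0 adjb comb bndb).
  apply: le_trans (iter_bound L0 adjb comb bndb _ _) _.
  by rewrite ler_wpM2l // (iter_adjoint_bound L0 adja coma bnda).
rewrite -exprM normrX ler_wiXn2l //; last exact: leq_pmulr.
exact: ltW.
Qed.

Lemma pair_sum_bound (M : R) (u : nat -> F) n : 0 <= M ->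
  (forall k, (0 < k)%N -> nrm (u k) <= M) ->
  nrm (\sum_(1 <= k < n.+1) iter k a (iter k b (u k))) ^+ 2 <=
  n%:R * (K ^+ 4 * M ^+ 2 * (1 + 2 / (1 - `|q|))).
Proof.
move=> M0 hu; set C := K ^+ 4 * M ^+ 2.
have -> : C * (1 + 2 / (1 - `|q|)) = C + 2 * C / (1 - `|q|) by ring.
have C0 : 0 <= C by rewrite mulr_ge0 ?exprn_ge0.
apply: almost_orthogonal_sum => //; first by rewrite normr_ge0.
  move=> k k0; rewrite /C (_ : _ * _ = (K * (K * M)) ^+ 2); last by ring.
  rewrite ler_pXn2r ?nnegrE ?nrm_ge0 ?mulr_ge0 //.
  apply: le_trans (iter_bound L0 adja coma bnda _ _) _; rewrite ler_wpM2l //.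
  by apply: le_trans (iter_bound L0 adjb comb bndb _ _) _; rewrite ler_wpM2l // hu.
move=> j k /[dup] jk /andP[j0 /(leq_ltn_trans _) k0].
apply: le_trans (pair_cross_bound _ _ jk) _.
rewrite ler_wpM2r ?exprn_ge0 // /C -mulrA ler_wpM2l ?exprn_ge0 // expr2.
by apply: ler_pM; rewrite ?nrm_ge0 ?hu ?k0.
Qed.

End Pair.
End AbstractEstimate.

Lemma Re_norm_ge0 (R : realType) (z : R[i]) : 0 <= complex.Re `|z|.
Proof. by rewrite normc_def sqrtr_ge0. Qed.

Lemma le0_eps (R : realType) (C A : R) : (forall e, 0 < e -> A <= C * e) -> A <= 0.
Proof.
move=> h; rewrite leNgt; apply/negP => A0.
have C1 : 0 < `|C| + 1 by rewrite ltr_wpDl.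
have C2 : 0 < 2 * (`|C| + 1) by rewrite mulr_gt0.
have := h _ (divr_gt0 A0 C2).
suff : C * (A / (2 * (`|C| + 1))) <= A / 2 by lra.
rewrite mulrCA ler_wpM2l ?(ltW A0) // ler_pdivrMr ?mulr_gt0 //.
by have := ler_norm C; lra.
Qed.

Section Total.
Variables (R : realType) (F : complexHilbertType R) (I : Type) (e : I -> F).
Hypothesis e_total : dense [set v | exists m (a : 'I_m -> R[i]) (s : 'I_m -> I),
  v = \sum_(k < m) a k *: e (s k)].

Lemma total_ind (P : F -> Prop) :
  (forall i, P (e i)) -> P 0 ->
  (forall a x y, P x -> P y -> P (a *: x + y)) ->
  (forall x, (forall eps : R, 0 < eps -> exists2 y, P y & nrm (x - y) < eps) -> P x) ->
  forall x, P x.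
Proof.
move=> Pe P0 Plin Plim x; apply: Plim => eps eps0.
have epsC0 : 0 < eps%:C :> R[i] by rewrite ltcR.
have [|y [/interior_subset]] := e_total _ (open_interior (ball x eps%:C)).
  by exists x; apply: nbhsx_ballx.
rewrite -ball_normE /= nrmE ltcR => xy [m [a [s ys]]]; exists y => //.
rewrite {}ys {xy}; elim: m a s => [|m IH] a s; first by rewrite big_ord0.
by rewrite big_ord_recl; apply: Plin.
Qed.

Lemma total_linear_eq0 (f : {linear F -> F}) (K : R) :
  (forall v, nrm (f v) <= K * nrm v) -> (forall i, f (e i) = 0) ->
  forall v, f v = 0.
Proof.
move=> fK fe; apply: total_ind => //; first exact: linear0.
  by move=> a x y fx fy; rewrite linearP fx fy scaler0 addr0.
move=> x hx; apply/eqP; rewrite -nrm_eq0 eq_le nrm_ge0 andbT.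
apply: (@le0_eps _ `|K|) => eps /hx[y fy xy].
rewrite -[f x](subr0) -fy -linearB (le_trans (fK _)) //.
rewrite (le_trans (ler_wpM2r (nrm_ge0 _) (ler_norm K))) //.
by rewrite ler_wpM2l // ltW.
Qed.

Variables (c : {linear F -> F}) (L : R).
Hypothesis cL : forall v, nrm (c v) <= L * nrm v.

Let L0 : 0 <= `|L| := normr_ge0 L.

Let cL' v : nrm (c v) <= `|L| * nrm v.
Proof. by rewrite (le_trans (cL _)) // ler_wpM2r ?nrm_ge0 ?ler_norm. Qed.

(* The real dot product is only real-bilinear, while [e] is total for complex
   combinations: hence the scalar [z]. *)
Lemma total_adjoint_eq v w :
  (forall i (z : R[i]), rdot (c (z *: e i)) v = rdot (z *: e i) w) ->
  forall u, rdot (c u) v = rdot u w.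
Proof.
move=> h u; suff H : forall z : R[i], rdot (c (z *: u)) v = rdot (z *: u) w.
  by have := H 1; rewrite scale1r.
move: u; apply: total_ind => //.
- by move=> z; rewrite scaler0 linear0 rdotC rdot0r rdotC rdot0r.
- move=> a x y hx hy z.
  by rewrite scalerDr linearD !rdotDl hy scalerA hx.
move=> x hx z; apply/eqP; rewrite -subr_eq0 -normr_eq0 eq_le normr_ge0 andbT.
apply: (@le0_eps _ ((`|L| * nrm v + nrm w) * complex.Re `|z|)) => eps /hx[y hy xy].
have -> : rdot (c (z *: x)) v - rdot (z *: x) w =
    rdot (c (z *: (x - y))) v - rdot (z *: (x - y)) w.
  by rewrite scalerBr linearB !rdotBl hy; ring.
apply: le_trans (ler_normB _ _) _.
have zxy : nrm (z *: (x - y)) <= complex.Re `|z| * eps.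
  by rewrite nrmZ ler_wpM2l ?(ltW xy) // Re_norm_ge0.
rewrite -mulrA mulrDl; apply: lerD; apply: le_trans (normr_rdot_le _ _) _.
  rewrite mulrAC ler_wpM2r ?nrm_ge0 // (le_trans (cL' _)) // ler_wpM2l //.
by rewrite mulrC ler_wpM2l ?nrm_ge0.
Qed.

(* The set of vectors having an image under the adjoint is a closed subspace,
   hence everything as soon as it contains a total family; this replaces the
   Riesz representation theorem. *)
Lemma adjoint_exists :
  (forall i, exists w, forall u, rdot (c u) (e i) = rdot u w) ->
  exists c' : {linear F -> F}, forall u v, rdot (c u) v = rdot u (c' v).
Proof.
move=> he.
have ex v : exists w, forall u, rdot (c u) v = rdot u w.
  move: v; apply: total_ind => //.
  - by exists 0 => u; rewrite !rdot0r.
  - move=> a x y [wx hx] [wy hy]; exists (a *: wx + wy) => u.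
    by rewrite !rdotDr hy [in LHS]rdot_conj -linearZ hx -rdot_conj.
  move=> x hx.
  have hn n : exists p : F * F,
      (forall u, rdot (c u) p.1 = rdot u p.2) /\ nrm (x - p.1) < n.+1%:R^-1.
    have [|y [w hw] xy] := hx (n.+1%:R^-1); first by rewrite invr_gt0.
    by exists (y, w).
  have [p hp] := choice hn.
  pose w n := (p n).2.
  have dist m n : nrm (w m - w n) <= `|L| * (m.+1%:R^-1 + n.+1%:R^-1).
    apply: nrm_le_dual => [|u]; first by rewrite mulr_ge0 // addr_ge0.
    rewrite rdotBr -!(proj1 (hp _)) -rdotBr (le_trans (rdot_le _ _)) //.
    rewrite mulrAC; apply: ler_pM; rewrite ?nrm_ge0 //.
    rewrite (_ : _ - _ = (x - (p n).1) - (x - (p m).1)); last first.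
      by rewrite opprB [RHS]addrC addrA subrK.
    by rewrite (le_trans (nrmB _ _)) // addrC; apply: lerD; apply/ltW/(proj2 (hp _)).
  have /cvg_ex[l wl] : cvgn w.
    apply: cauchy_cvg; apply: cauchy_exP => eps eps0.
    have epsE : eps = (complex.Re eps)%:C by rewrite RRe_real ?gtr0_real.
    have {}eps0 : 0 < complex.Re eps by rewrite -ltcR -epsE.
    have d0 : 0 < complex.Re eps / (2 * (`|L| + 1)).
      by rewrite divr_gt0 // mulr_gt0 // ltr_wpDl.
    have [N _ hN] := near_infty_natSinv_lt (PosNum d0).
    exists (w N), N => // n /= Nn.
    rewrite -ball_normE /= nrmE epsE ltcR (le_lt_trans (dist _ _)) //.
    have h1 := hN N (leqnn N); have h2 := hN n Nn; rewrite /= in h1 h2.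
    apply: (@le_lt_trans _ _ ((`|L| + 1) * (N.+1%:R^-1 + n.+1%:R^-1))).
      by rewrite ler_wpM2r ?addr_ge0 // lerDl.
    have L1 : 0 < 2 * (`|L| + 1) by rewrite mulr_gt0 // ltr_wpDl.
    rewrite !ltr_pdivlMr // in h1 h2.
    move: (N.+1%:R^-1 : R) (n.+1%:R^-1 : R) (complex.Re eps : R) h1 h2 => s t d h1 h2.
    lra.
  exists l => u; apply/eqP; rewrite -subr_eq0 -normr_eq0 eq_le normr_ge0 andbT.
  apply: (@le0_eps _ (nrm (c u) + nrm u)) => eps eps0.
  have epsC0 : 0 < eps%:C :> R[i] by rewrite ltcR.
  have [N1 _ h1] := near_infty_natSinv_lt (PosNum eps0).
  have [N2 _ h2] := (iffLR (cvgrPdist_lt _ _) wl) _ epsC0.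
  pose n := maxn N1 N2.
  have {}h1 := h1 n (leq_maxl _ _); have {}h2 := h2 n (leq_maxr _ _).
  rewrite /= nrmE ltcR in h1 h2.
  have -> : rdot (c u) x - rdot u l = rdot (c u) (x - (p n).1) - rdot u (l - w n).
    by rewrite !rdotBr (proj1 (hp n)) /w; ring.
  rewrite (le_trans (ler_normB _ _)) // mulrDl; apply: lerD.
    apply: le_trans (normr_rdot_le _ _) _; rewrite ler_wpM2l ?nrm_ge0 //.
    exact: ltW (lt_trans (proj2 (hp n)) h1).
  apply: le_trans (normr_rdot_le _ _) _; rewrite ler_wpM2l ?nrm_ge0 //.
  exact: ltW h2.
have [f hf] := choice ex.
have f_lin : linear f.
  move=> a x y; apply: rdot_inj => u.
  by rewrite -hf !rdotDr -hf rdot_conj [in RHS]rdot_conj -hf linearZ.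
pose fL := GRing.isLinear.Build _ _ _ _ f f_lin.
pose c' : {linear F -> F} := HB.pack f fL.
by exists c'.
Qed.

End Total.

Section Fock.
Variables (R : realType) (q : R) (H F : complexHilbertType R).
Variable tens : seq H -> F.
Hypothesis hq : -1 < q < 1.
Hypothesis hF : q_fock q tens.

Lemma q_fock_rev : q_fock q (tens \o rev).
Proof.
case: hF => lin form tot; split=> [s t a x y|s t|].
- by rewrite /= !rev_cat !rev_cons !cat_rcons lin.
- by rewrite /= form q_form_rev.
move=> O O0 Oo; have [v [Ov [m [a [s vE]]]]] := tot O O0 Oo.
exists v; split=> //; exists m, a, (rev \o s).
by rewrite vE; apply: eq_bigr => k _; rewrite /= revK.
Qed.

Definition annihilation x t : F :=
  \sum_(i < size t) (q%:C ^+ i * inner x t`_i) *: tens (delete_nth i t).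

Lemma inner_tens_cons x s t :
  inner (tens (x :: s)) (tens t) = inner (tens s) (annihilation x t).
Proof.
case: hF => _ form _; rewrite form q_form_cons inner_sumr.
by apply: eq_bigr => i _; rewrite innerZr form.
Qed.

Variable c : H -> {linear F -> F}.
Hypothesis hc : left_creation tens c.

Lemma annihilation_cons x y t :
  annihilation x (y :: t) = inner x y *: tens t + q%:C *: c y (annihilation x t).
Proof.
rewrite /annihilation /= big_ord_recl /= expr0 mul1r /delete_nth /= drop0.
congr (_ + _); rewrite linear_sum scaler_sumr; apply: eq_bigr => i _.
rewrite linearZ /= scalerA (hc y).2 mulrA -exprS.
by [].
Qed.

Lemma creation_bound x : exists2 L : R, 0 <= L & forall v, nrm (c x v) <= L * nrm v.
Proof.
have [[M hM] _] := hc x; exists `|M| => // v.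
apply: (@le_trans _ _ (M * nrm v)); first by rewrite -nrm_le.
by rewrite ler_wpM2r ?nrm_ge0 ?ler_norm.
Qed.

Lemma creation_adjoint x : exists c' : {linear F -> F},
  (forall u v, rdot (c x u) v = rdot u (c' v)) /\
  forall t, c' (tens t) = annihilation x t.
Proof.
have [L L0 cL] := creation_bound x; have [_ _ tot] := hF.
have e t u : rdot (c x u) (tens t) = rdot u (annihilation x t).
  move: u; apply: (total_adjoint_eq tot cL) => s z.
  by rewrite linearZ /= (hc x).2 /rdot !innerZl inner_tens_cons.
have [t|c' hc'] := adjoint_exists tot cL; first by exists (annihilation x t).
by exists c'; split=> // t; apply: rdot_inj => u; rewrite -hc' e.
Qed.

Lemma q_commutation x y (c' : {linear F -> F}) :
  (forall u v, rdot (c x u) v = rdot u (c' v)) ->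
  (forall t, c' (tens t) = annihilation x t) ->
  forall v, c' (c y v) = inner x y *: v + q%:C *: c y (c' v).
Proof.
move=> adj c't v; have [_ _ tot] := hF.
have [Lx Lx0 cx] := creation_bound x; have [Ly Ly0 cy] := creation_bound y.
have c'x := nrm_adjoint Lx0 adj cx.
pose f : {linear F -> F} :=
  (c' \o c y) \- ((inner x y \*: idfun) \+ (q%:C \*: (c y \o c'))).
apply/eqP; rewrite -subr_eq0; apply/eqP.
apply: (@total_linear_eq0 _ _ _ _ tot f
  (Lx * Ly + (complex.Re `|inner x y| + `|q| * (Ly * Lx)))) => [u|t] /=.
  apply: le_trans (nrmB _ _) _; rewrite mulrDl; apply: lerD.
    by apply: le_trans (c'x _) _; rewrite -mulrA ler_wpM2l ?cy.
  apply: le_trans (nrmD _ _) _; rewrite nrmZ nrmZr mulrDl lerD2l -!mulrA.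
  by rewrite ler_wpM2l // (le_trans (cy _)) // ler_wpM2l ?c'x.
by rewrite (hc y).2 !c't annihilation_cons subrr.
Qed.

Lemma creation_average_bound (xi eta : H) (T : nat -> {linear F -> F}) :
  xi != 0 -> eta != 0 -> inner xi eta = 0 ->
  (exists M : R, forall k, (1 <= k)%N -> forall v, `|T k v| <= M%:C * `|v|) ->
  exists2 C : R, 0 <= C & forall n v, (0 < n)%N -> nrm v <= 1 ->
    nrm (creation_average q c xi eta T n v) ^+ 2 <= C / n%:R.
Proof.
move=> xi0 eta0 xi_eta [M hM].
have [cx [adjx annx]] := creation_adjoint xi.
have [cy [adjy anny]] := creation_adjoint eta.
have [Lx Lx0 hLx] := creation_bound xi; have [Ly Ly0 hLy] := creation_bound eta.
have q1 : 0 <= 1 - q by case/andP: hq; lra.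
pose al (x : H) := Num.sqrt (1 - q) / nrm x.
have al0 x : 0 <= al x by rewrite divr_ge0 ?sqrtr_ge0 ?nrm_ge0.
have alE x : x != 0 -> al x * al x * nrm x ^+ 2 = 1 - q.
  rewrite -nrm_eq0 => x0; rewrite /al -[RHS](sqr_sqrtr q1).
  by field.
pose a : {linear F -> F} := (al xi)%:C \*: c xi.
pose a' : {linear F -> F} := (al xi)%:C \*: cx.
pose b : {linear F -> F} := (al eta)%:C \*: c eta.
pose b' : {linear F -> F} := (al eta)%:C \*: cy.
pose L := al xi * Lx + al eta * Ly.
have inn (x : H) : inner x x = (nrm x ^+ 2)%:C.
  by rewrite /inner dotform_norm nrmE rmorphXn.
have adja u v : rdot (a u) v = rdot u (a' v) by rewrite rdotZl rdotZr adjx.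
have adjb u v : rdot (b u) v = rdot u (b' v) by rewrite rdotZl rdotZr adjy.
have com x (x' : {linear F -> F}) v : x != 0 ->
    (forall u v, rdot (c x u) v = rdot u (x' v)) ->
    (forall t, x' (tens t) = annihilation x t) ->
    (al x)%:C *: x' ((al x)%:C *: c x v) =
    (1 - q)%:C *: v + q%:C *: ((al x)%:C *: c x ((al x)%:C *: x' v)).
  move=> x0 adj ann; rewrite !linearZ /= (q_commutation x adj ann) inn !scalerDr !scalerA.
  by rewrite -!rmorphM alE.
have L0 : 0 <= L by rewrite addr_ge0 // mulr_ge0.
have bnda v : nrm (a v) <= L * nrm v.
  rewrite /= nrmZr ger0_norm // mulrDl ler_wpDr //.
    exact: mulr_ge0 (mulr_ge0 (al0 _) Ly0) (nrm_ge0 _).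
  by rewrite -mulrA ler_wpM2l ?hLx.
have bndb v : nrm (b v) <= L * nrm v.
  rewrite /= nrmZr ger0_norm // mulrDl ler_wpDl //.
    exact: mulr_ge0 (mulr_ge0 (al0 _) Lx0) (nrm_ge0 _).
  by rewrite -mulrA ler_wpM2l ?hLy.
have cross v : a' (b v) = q%:C *: b (a' v).
  rewrite /= !linearZ /= (q_commutation eta adjx annx) xi_eta scale0r add0r !scalerA.
  by congr (_ *: _); rewrite -!rmorphM; congr (_%:C); ring.
exists (osc_bound q L ^+ 4 * `|M| ^+ 2 * (1 + 2 / (1 - `|q|))).
  rewrite mulr_ge0 // ?mulr_ge0 ?exprn_ge0 ?expR_ge0 // addr_ge0 // divr_ge0 //.
  by rewrite subr_ge0 ltW // ltr_norml.
move=> n v n0 v1.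
have hT k : (0 < k)%N -> nrm (T k v) <= `|M|.
  move=> k0; have := hM k k0 v; rewrite nrm_le => h.
  apply: le_trans h _; rewrite -[leRHS]mulr1.
  by apply: le_trans (ler_wpM2r (nrm_ge0 v) (ler_norm M)) _; rewrite ler_wpM2l.
have := @pair_sum_bound R F q hq a a' b b' L L0 adja (fun v => com xi cx v xi0 adjx annx)
  bnda adjb (fun v => com eta cy v eta0 adjy anny) bndb cross `|M| (fun k => T k v) n
  (normr_ge0 M) hT.
have itE x k u : iter k ((al x)%:C \*: c x : {linear F -> F}) u
    = ((al x) ^+ k)%:C *: iter k (c x) u.
  elim: k => [|k IH]; first by rewrite expr0 scale1r.
  by rewrite /= IH linearZ /= scalerA -rmorphM exprS.
have -> : creation_average q c xi eta T n v =
    (n%:R^-1)%:C *: \sum_(1 <= k < n.+1) iter k a (iter k b (T k v)).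
  rewrite /creation_average; congr (_ *: _).
    by rewrite fmorphV rmorph_nat.
  apply: eq_bigr => k _; rewrite !itE linear_iter scalerA -rmorphM; congr (_ *: _).
  rewrite !nrmE -!rmorphXn -!fmorphV -!rmorphM; congr (_%:C).
  rewrite /al !exprMn !exprVn mulrACA -exprMn -[_ * Num.sqrt _]expr2 sqr_sqrtr //.
  by rewrite mulrA.
rewrite nrmZr exprMn normfV normr_nat => h.
rewrite exprVn mulrC ler_pdivrMr ?exprn_gt0 ?ltr0n //.
apply: le_trans h _; rewrite le_eqVlt; apply/orP; left; apply/eqP.
by field; rewrite pnatr_eq0 -lt0n n0 subr_eq0 gt_eqF // ltr_norml.
Qed.

Lemma creation_average_cvg (xi eta : H) (T : nat -> {linear F -> F}) :
  xi != 0 -> eta != 0 -> inner xi eta = 0 ->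
  (exists M : R, forall k, (1 <= k)%N -> forall v, `|T k v| <= M%:C * `|v|) ->
  opnorm (creation_average q c xi eta T n) @[n --> \oo] --> 0%E.
Proof.
move=> xi0 eta0 xi_eta hT.
have [C C0 hC] := creation_average_bound xi0 eta0 xi_eta hT.
apply: (@squeeze_cvge _ _ _ _ (fun=> 0%E) _ (fun n => (Num.sqrt (C / n%:R))%:E)).
- near=> n; have n0 : (0 < n)%N by near: n; exact: nbhs_infty_gt.
  apply/andP; split.
    apply: le_trans (ereal_sup_ubound _) => /=; last first.
      by exists 0; rewrite /= ?normr0.
    by rewrite lee_fin nrm_ge0.
  apply: ge_ereal_sup => _ [v /= v1 <-]; rewrite lee_fin -/(nrm _).
  rewrite -(@ler_pXn2r _ 2%N) ?nnegrE ?nrm_ge0 ?sqrtr_ge0 // sqr_sqrtr ?divr_ge0 //.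
  by apply: hC => //; rewrite -lecR -nrmE.
- exact: cvg_cst.
apply: cvg_EFin; first by near=> n.
have Cn : C / n%:R @[n --> \oo] --> (0 : R).
  rewrite -[X in _ --> X](mulr0 C); apply: cvgMr.
  apply/gtr0_cvgV0; last exact: cvgr_idn.
  by near=> n; rewrite ltr0n; near: n; exact: nbhs_infty_gt.
rewrite -[X in _ --> X](sqrtr0 R).
exact: cvg_comp Cn (@sqrt_continuous R 0).
Unshelve. all: by end_near.
Qed.

End Fock.

Theorem proposition3p4 (R : realType) (q : R) (hq : -1 < q < 1)
    (HR : realHilbertType R) (HRsep : separable HR) (HRdim : dim_ge2 HR)
    (U : R -> {linear HR -> HR}) (hU : orthogonal_group U)
    (HC : complexHilbertType R) (j : HR -> HC) (hj : complexification j)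
    (UC : R -> {linear HC -> HC}) (hUC : forall t x, UC t (j x) = j (U t x))
    (A : set (HC * HC)) (A_sa : self_adjoint A) (A_pos : positive_op A)
    (A_ns : nonsingular_op A) (hA : imaginary_powers A UC)
    (HU : complexHilbertType R) (iota : {linear HC -> HU})
    (hiota : deformed_completion A iota)
    (F : complexHilbertType R) (tens : seq HU -> F) (hF : q_fock q tens)
    (c r : HU -> {linear F -> F})
    (hc : left_creation tens c) (hr : right_creation tens r)
    (xi eta : HU) (xi_neq0 : xi != 0) (eta_neq0 : eta != 0)
    (xi_eta : inner xi eta = 0)
    (T : nat -> {linear F -> F})
    (hT : exists M : R, forall k, (1 <= k)%N ->
            forall v, `|T k v| <= M%:C * `|v|) :
  (opnorm (creation_average q c xi eta T n) @[n --> \oo] --> 0%E) /\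
  (opnorm (creation_average q r xi eta T n) @[n --> \oo] --> 0%E).
Proof.
split; first exact: (creation_average_cvg hq hF hc).
apply: (creation_average_cvg hq (q_fock_rev hF)) => // x.
by have [? rx] := hr x; split=> // s; rewrite /= rx rev_cons.
Qed.
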